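(* Let $n>1$ be an almost-prime number. Then $n$ is either a prime or a Carmichael number.
   Context: For a positive integer $n$ with positive divisors $1=d_1<d_2<\dots<d_k=n$, define the polynomial $T_n(x)=x^{d_1}+x^{d_2}+\dots+x^{d_k}-kx$. A positive integer $n$ is called weakly almost-prime if $n\mid T_n(x)$ for all integers $x$; it is called almost-prime if it is weakly almost-prime and square-free. A Carmichael number is a composite positive integer $n$ such that $a^n\equiv a \pmod n$ for every integer $a$. *)

(* Defs.v *)
From mathcomp Require Import all_boot all_order all_algebra.

Set Implicit Arguments.
Unset Strict Implicit.
Unset Printing Implicit Defensive.

Import GRing.Theory.
Local Open Scope ring_scope.

Definition T (n : nat) : {poly int} :=
  (\sum_(d <- divisors n) 'X^d) - (size (divisors n))%:R *: 'X.

(* [0 < n] is needed: [divisors 0] is empty, so [T 0 = 0]. *)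
Definition weakly_almost_prime (n : nat) : Prop :=
  (0 < n)%N /\ forall x : int, (n%:Z %| (T n).[x])%Z.

Definition squarefree (n : nat) : Prop :=
  forall d : nat, (d ^ 2 %| n)%N -> d = 1%N.

Definition almost_prime (n : nat) : Prop :=
  weakly_almost_prime n /\ squarefree n.

Definition composite (n : nat) : bool := (1 < n)%N && ~~ prime n.

Definition carmichael (n : nat) : Prop :=
  composite n /\ forall a : int, (a ^+ n = a %[mod n%:Z])%Z.

(* Main.v *)
(* Fix a prime p | n and let k be the number of divisors of n. Over F_p the
   hypothesis says that, among the divisors d of n, each residue class mod p - 1
   occurs 0 times mod p, except the class of 1, which occurs k times mod p.
   Since k is a power of 2, it is nonzero mod p when p > 2. This forces n to be
   coprime to p - 1, and then the involution d |-> n / d shows that the class of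
   n is also nonzero mod p, so p - 1 | n - 1. Conclude by Korselt's criterion. *)

Require Import Defs.
From mathcomp Require Import all_boot all_order all_algebra.
From mathcomp Require Import all_field.

Import GRing.Theory.

Section AlmostPrime.

Set Implicit Arguments.
Unset Strict Implicit.

Local Open Scope ring_scope.

Lemma card_nonzero_Fp (p : nat) : prime p ->
  size [seq y <- enum 'F_p | y != 0] = p.-1.
Proof.
move=> pp; have -> : p.-1 = #|predC1 (0 : 'F_p)|.
  by rewrite -{1}(card_Fp pp) (cardC1 (0 : 'F_p)).
by rewrite cardE enumT; congr size; apply: eq_filter => y; rewrite !inE.
Qed.

Lemma Fp_expf (p d : nat) (y : 'F_p) : prime p -> y != 0 ->
  y ^+ (d %% p.-1) = y ^+ d.
Proof.
move=> pp y0; have yp1 : y ^+ p.-1 = 1.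
  apply: (mulfI y0); rewrite -exprS mulr1 prednK ?prime_gt0 //.
  by have := expf_card y; rewrite card_Fp.
by rewrite {2}(divn_eq d p.-1) exprD mulnC exprM yp1 expr1n mul1r.
Qed.

(* Dividing T_n by x and reducing the exponents mod p - 1 gives a polynomial
   of degree < p - 1 with p - 1 roots in 'F_p. *)
Lemma reduced_T_eq0 (n p : nat) :
  prime p -> (p %| n)%N -> weakly_almost_prime n ->
  \sum_(d <- divisors n) 'X^(d.-1 %% p.-1) - (size (divisors n))%:R%:P = 0
    :> {poly 'F_p}.
Proof.
move=> pp pn [n0 wn]; set Q := (X in X = 0).
have p1 : (0 < p.-1)%N by rewrite -ltnS prednK ?prime_gt0 ?prime_gt1.
have szQ : (size Q <= p.-1)%N.
  apply: (leq_trans (size_polyD _ _)); rewrite geq_max size_polyN.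
  rewrite (leq_trans (size_polyC_leq1 _)) // andbT.
  apply: (leq_trans (size_sum _ _ _)); apply/bigmax_leqP_seq => d _ _.
  by rewrite size_polyXn ltn_mod.
apply/eqP/negPn/negP => Q0.
have := @max_poly_roots _ Q [seq y <- enum 'F_p | y != 0] Q0.
rewrite card_nonzero_Fp // ltnNge szQ filter_uniq ?enum_uniq // => H.
suff /H/(_ isT): all (root Q) [seq y <- enum 'F_p | y != 0] by [].
apply/allP => y; rewrite mem_filter => /andP[y0 _].
(* Multiplying by the nonzero [y] restores the factor x divided out of T_n, so [y * Q.[y]] is the
   image of T_n(y) in ['F_p]. *)
rewrite rootE -(mulrI_eq0 _ (mulfI y0)).
have : (p%:Z %| (T n).[(y : nat)%:Z])%Z.
  by apply: dvdz_trans (wn _); rewrite dvdzE.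
rewrite (dvdz_pcharf (pchar_Fp pp)) => /eqP <-; apply/eqP.
have yE : ((y : nat)%:Z)%:~R = y by rewrite -[RHS]natr_Zp.
rewrite /Q /T !(hornerD, hornerN, horner_sum, hornerC, hornerZ, hornerX).
rewrite rmorphB rmorphM rmorph_sum /= yE rmorph_nat mulrBr mulr_sumr.
rewrite [y * _%:R]mulrC; congr (_ - _); apply: eq_big_seq => d.
rewrite -dvdn_divisors // !hornerXn => dn.
rewrite Fp_expf // -exprS prednK ?(dvdn_gt0 n0 dn) //.
by rewrite rmorphXn /= yE.
Qed.

(** For j < p - 1, the coefficient of X^j in the vanishing polynomial counts the divisors d with d -
    1 congruent to j mod p - 1, minus k when j = 0. Summing over the residues j that satisfy [P]
    gives the count. *)
Lemma count_divisors_mod (n p : nat) (P : pred nat) :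
  prime p -> (p %| n)%N -> weakly_almost_prime n ->
  (count (fun d => P (d.-1 %% p.-1)%N) (divisors n))%:R
    = (P 0%N)%:R * (size (divisors n))%:R :> 'F_p.
Proof.
move=> pp pn wn; have p1 : (0 < p.-1)%N.
  by rewrite -ltnS prednK ?prime_gt0 ?prime_gt1.
have coefE (j : nat) : \sum_(d <- divisors n) (j == d.-1 %% p.-1)%N%:R
    = (j == 0%N)%:R * (size (divisors n))%:R :> 'F_p.
  move/eqP: (reduced_T_eq0 pp pn wn); rewrite subr_eq0 => /eqP.
  move/(congr1 (fun q : {poly 'F_p} => q`_j)); rewrite coef_sum coefC.
  under eq_bigr do rewrite coefXn.
  by move->; case: (j == 0%N); rewrite ?mul1r ?mul0r.
rewrite -sum1_count big_mkcond natr_sum /=.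
transitivity (\sum_(d <- divisors n) \sum_(j < p.-1)
    (P j)%:R * ((j : nat) == d.-1 %% p.-1)%N%:R : 'F_p).
  apply: eq_bigr => d _; rewrite (bigD1 (Ordinal (ltn_pmod d.-1 p1))) //=.
  rewrite eqxx mulr1 big1 ?addr0; first by case: (P _).
  by move=> j /negPf; rewrite -val_eqE /= => ->; rewrite mulr0.
rewrite exchange_big /=; under eq_bigr do rewrite -mulr_sumr coefE.
rewrite (bigD1 (Ordinal p1)) //= mul1r big1 ?addr0 // => j /negPf.
by rewrite -val_eqE /= => ->; rewrite mul0r mulr0.
Qed.

Lemma perm_divisors_mul (q m : nat) : prime q -> ~~ (q %| m)%N -> (0 < m)%N ->
  perm_eq (divisors (q * m)%N)
          (divisors m ++ [seq (q * d)%N | d <- divisors m]).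
Proof.
move=> pq qm m0; have q0 := prime_gt0 pq.
apply: uniq_perm; first exact: divisors_uniq.
  rewrite cat_uniq divisors_uniq map_inj_uniq ?divisors_uniq ?andbT /=; last first.
    by move=> a b /eqP; rewrite eqn_pmul2l // => /eqP.
  apply/hasPn => _ /mapP[d _ ->]; rewrite /= -dvdn_divisors //.
  by apply: contra qm; apply: dvdn_trans; apply: dvdn_mulr.
move=> d; rewrite mem_cat -!dvdn_divisors ?muln_gt0 ?q0 //.
apply/idP/orP => [dqm|[dm|/mapP[e]]]; first 1 last.
- exact: dvdn_mull.
- by rewrite -dvdn_divisors // => em ->; rewrite dvdn_pmul2l.
have [/dvdnP[e dE]|qd] := boolP (q %| d)%N.
  right; apply/mapP; exists e; last by rewrite dE mulnC.
  by rewrite -dvdn_divisors // -(dvdn_pmul2l q0) mulnC -dE.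
by left; rewrite -(@Gauss_dvdr _ q) // coprime_sym prime_coprime.
Qed.

Lemma squarefree_cofactor (q m : nat) : prime q -> squarefree (q * m)%N ->
  ~~ (q %| m)%N /\ squarefree m.
Proof.
move=> pq sf; split.
  apply/negP => qm; have q1 : q = 1%N by apply: sf; rewrite -mulnn dvdn_mul.
  by rewrite q1 in pq.
by move=> d dm; apply: sf; apply: dvdn_mull.
Qed.

Lemma size_divisors_mul (q m : nat) : prime q -> ~~ (q %| m)%N -> (0 < m)%N ->
  size (divisors (q * m)%N) = (2 * size (divisors m))%N.
Proof.
move=> pq qm m0; rewrite (perm_size (perm_divisors_mul pq qm m0)).
by rewrite size_cat size_map mul2n addnn.
Qed.

Lemma count_ndvd_divisors (q m : nat) :
  prime q -> ~~ (q %| m)%N -> (0 < m)%N ->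
  count (fun d => ~~ (q %| d)%N) (divisors (q * m)%N) = size (divisors m).
Proof.
move=> pq qm m0; rewrite (permP (perm_divisors_mul pq qm m0)) count_cat.
rewrite count_map [X in (_ + X)%N](@eq_count _ _ pred0); last first.
  by move=> d /=; rewrite dvdn_mulr.
rewrite count_pred0 addn0; apply/eqP; rewrite -all_count; apply/allP => d.
by rewrite -dvdn_divisors // => dm; apply: contra qm => /dvdn_trans->.
Qed.

(** Each prime factor of a square-free number doubles its number of divisors, which is therefore a
    power of 2. *)
Lemma prime_ndvd_size_divisors (n p : nat) : (0 < n)%N -> squarefree n ->
  prime p -> (2 < p)%N -> ~~ (p %| size (divisors n))%N.
Proof.
move=> + + pp p2; elim/ltn_ind: n => n IH n0 sf.
have [n1|n1] := leqP n 1.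
  have -> : n = 1%N by apply/eqP; rewrite eqn_leq n1.
  by rewrite /= dvdn1; apply: contraTN p2 => /eqP->.
have pq := pdiv_prime n1; have /dvdnP[m nE] := pdiv_dvd n.
rewrite mulnC in nE; move: pq nE; set q := pdiv n => pq nE.
have m0 : (0 < m)%N by move: n0; rewrite nE muln_gt0 => /andP[].
have [qm sfm] : ~~ (q %| m)%N /\ squarefree m.
  by apply: squarefree_cofactor => //; rewrite -nE.
rewrite nE size_divisors_mul // Euclid_dvdM // negb_or IH // ?andbT.
  by rewrite gtnNdvd.
by rewrite nE ltn_Pmull ?prime_gt1.
Qed.

(* The number of divisors prime to q is k / 2, but if q | p - 1 then counting
   them mod p gives k: all of them come from the class of 1. *)
Lemma almost_prime_coprime (n p q : nat) : almost_prime n ->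
  prime p -> (2 < p)%N -> (p %| n)%N -> prime q -> (q %| n)%N ->
  ~~ (q %| p.-1)%N.
Proof.
move=> [wn sf] pp p2 pn pq /dvdnP[m]; rewrite mulnC => nE; apply/negP => qp.
have n0 := proj1 wn.
have m0 : (0 < m)%N by move: n0; rewrite nE muln_gt0 => /andP[].
have [qm sfm] : ~~ (q %| m)%N /\ squarefree m.
  by apply: squarefree_cofactor => //; rewrite -nE.
(* As q | p - 1, divisibility of d by q depends only on the residue j of d - 1 mod p - 1, and
   amounts to q | j + 1. *)
have := count_divisors_mod (fun j => ~~ (q %| j.+1)%N) pp pn wn.
rewrite (@eq_in_count _ _ (fun d => ~~ (q %| d)%N)); last first.
  move=> d; rewrite -dvdn_divisors // => dn; have d0 := dvdn_gt0 n0 dn.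
  congr (~~ _); rewrite -[in RHS](prednK d0) [in RHS](divn_eq d.-1 p.-1).
  by rewrite -addnS dvdn_addr // dvdn_mull.
rewrite nE count_ndvd_divisors // size_divisors_mul // dvdn1.
have -> /= : (q != 1)%N by apply: contraTN pq => /eqP->.
(* With c the number of divisors of [m], this reads c = 2c in ['F_p], so p | c, which is impossible
   for a square-free [m] and p > 2. *)
rewrite mul1r natrM mulrDl mul1r => /eqP; rewrite eq_sym -subr_eq0 addrK.
rewrite -(dvdn_pcharf (pchar_Fp pp)); apply/negP.
exact: prime_ndvd_size_divisors.
Qed.

(* d |-> n / d exchanges the divisors congruent to n and those congruent to 1;
   the latter class is nonempty mod p, hence so is the former. *)
Lemma almost_prime_dvd_pred (n p : nat) : almost_prime n ->
  prime p -> (p %| n)%N -> (p.-1 %| n.-1)%N.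
Proof.
move=> apn pp pn; have [wn sf] := apn; have n0 := proj1 wn.
have [p2|p2] := leqP p 2.
  have -> : p = 2%N by apply/eqP; rewrite eqn_leq p2 prime_gt1.
  exact: dvd1n.
have co d : (d %| n)%N -> coprime p.-1 d.
  move=> dn; rewrite coprime_has_primes ?(dvdn_gt0 n0 dn) //; last first.
    by rewrite -ltnS prednK ?prime_gt0 ?prime_gt1.
  apply/hasPn => q; rewrite mem_primes => /and3P[pq _ qd].
  rewrite mem_primes pq /= negb_and; apply/orP; right.
  exact: (almost_prime_coprime apn pp p2 pn pq (dvdn_trans qd dn)).
have perm_inv : perm_eq (divisors n) [seq (n %/ d)%N | d <- divisors n].
  have divK d : (d %| n)%N -> (n %/ (n %/ d))%N = d.
    by move=> dn; rewrite divnA // mulKn.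
  apply: uniq_perm; first exact: divisors_uniq.
    rewrite map_inj_in_uniq ?divisors_uniq // => a b.
    rewrite -!dvdn_divisors // => an bn E.
    by rewrite -(divK a an) E divK.
  move=> d; rewrite -dvdn_divisors //; apply/idP/mapP => [dn|[e]].
    by exists (n %/ d)%N; rewrite ?divK // -dvdn_divisors // dvdn_div.
  by rewrite -dvdn_divisors // => en ->; apply: dvdn_div.
have H1 := count_divisors_mod (fun j => j == 0%N) pp pn wn.
have Hn := count_divisors_mod (fun j => j == n.-1 %% p.-1)%N pp pn wn.
have E : count (fun d => d.-1 %% p.-1 == n.-1 %% p.-1)%N (divisors n)
       = count (fun d => d.-1 %% p.-1 == 0)%N (divisors n).
  rewrite [RHS](permP perm_inv) count_map; apply: eq_in_count => d.
  rewrite -dvdn_divisors // => dn /=; have d0 := dvdn_gt0 n0 dn.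
  (* Since n - d = d (n/d - 1) and d is coprime to p - 1, d is congruent to n mod p - 1 exactly when
     n/d is congruent to 1. *)
  rewrite eq_sym eqn_mod_dvd; last by rewrite -!subn1 leq_sub2r // dvdn_leq.
  have -> : (n.-1 - d.-1 = d * (n %/ d).-1)%N.
    rewrite -!subn1 subnBA // subnK // mulnBr muln1.
    by rewrite mulnC divnK.
  by rewrite Gauss_dvdr ?co.
move: Hn; rewrite E H1 eqxx mul1r eq_sym.
(* Were n not congruent to 1 mod p - 1, its class would occur 0 times mod p; but it occurs as often
   as the class of 1, so p | k. *)
have [/eqP //|_] := eqVneq (n.-1 %% p.-1)%N 0%N; rewrite mul0r => /eqP.
rewrite -(dvdn_pcharf (pchar_Fp pp)) => pk.
by have := prime_ndvd_size_divisors n0 sf pp p2; rewrite pk.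
Qed.

Lemma squarefree_dvdn (n m : nat) : (0 < n)%N -> squarefree n ->
  (forall p, prime p -> (p %| n)%N -> (p %| m)%N) -> (n %| m)%N.
Proof.
move=> n0 sf H; apply/dvdn_partP => // p; rewrite mem_primes => /and3P[pp _ pn].
rewrite p_part; suff : (logn p n <= 1)%N.
  by case: (logn p n) => [|[|]] // _; rewrite ?dvd1n // H.
rewrite leqNgt; apply/negP => l2; have p1 : p = 1%N.
  by apply: sf; rewrite pfactor_dvdn.
by rewrite p1 in pp.
Qed.

(** The sufficiency half of Korselt's criterion at one prime: a^(n-1) = 1 in ['F_p] when a is
    nonzero there. [squarefree_dvdn] then combines the primes. *)
Lemma dvdz_fermat (n p : nat) (a : int) : (0 < n)%N -> prime p ->
  (p.-1 %| n.-1)%N -> (p%:Z %| a ^+ n - a)%Z.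
Proof.
move=> n0 pp pn; rewrite (dvdz_pcharf (pchar_Fp pp)) rmorphB rmorphXn /=.
rewrite subr_eq0; have [->|a0] := eqVneq (a%:~R : 'F_p) 0.
  by rewrite expr0n -[n]prednK.
by rewrite -{1}(prednK n0) exprS -Fp_expf // (eqP pn) expr0 mulr1.
Qed.

End AlmostPrime.

Theorem theorem1p5 (n : nat) (hn : 1 < n) (han : almost_prime n) :
  prime n \/ carmichael n.
Proof.
have [pn|npn] := boolP (prime n); [by left | right].
have n0 := ltnW hn; split=> [|a]; first by rewrite /composite hn.
apply/eqP; rewrite eqz_mod_dvd dvdzE.
apply: squarefree_dvdn => //; first exact: (proj2 han).
move=> p pp pn; have := @dvdz_fermat n p a n0 pp.
by rewrite dvdzE; apply; apply: almost_prime_dvd_pred.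
Qed.
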